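(* Let $V$ be a vector space of finite dimension over a field $\mathbb{K}$ with $\operatorname{char}(\mathbb{K})\neq 2$, fix a basis $B$ of $V$, and let $\mathcal{F}=\{\langle\cdot,\cdot\rangle_i\}_{i\in I\cup\{0\}}$ be a family of inner products on $V$ whose Gram matrices relative to $B$ are $M_{i,B}$ ($i\in I\cup\{0\}$). Assume that $M_{0,B}$ is nonsingular. Then $\mathcal{F}$ is simultaneously orthogonalizable if and only if the collection of matrices $\{M_{i,B}M_{0,B}^{-1}\}_{i\in I}$ is commutative (its members commute pairwise) and each one of them is diagonalizable over $\mathbb{K}$.
   Context: An inner product on a $\mathbb{K}$-vector space $V$ means a symmetric bilinear form $V\times V\to\mathbb{K}$ (possibly degenerate). For a basis $B=\{v_j\}$ of $V$, the matrix of $\langle\cdot,\cdot\rangle_i$ in $B$ is the Gram matrix $M_{i,B}=(\langle v_j,v_k\rangle_i)_{j,k}$. A family of inner products on $V$ is simultaneously orthogonalizable if there is a single basis $\{w_j\}$ of $V$ such that $\langle w_j,w_k\rangle=0$ whenever $j\neq k$, for every inner product $\langle\cdot,\cdot\rangle$ in the family (isotropic basis vectors are allowed). *)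

(* Defs.v *)
From HB Require Import structures.
From mathcomp Require Import all_boot all_order all_algebra.

Set Implicit Arguments.
Unset Strict Implicit.
Unset Printing Implicit Defensive.

Import GRing.Theory.
Local Open Scope ring_scope.

(* An inner product is a symmetric bilinear form, possibly degenerate: an
   element of {symmetric V}, which expands to {hermitian V for false & idfun}
   and whose symmetry axiom reads f u v = (-1) ^+ false * idfun (f v u). *)

Definition gram (K : fieldType) (V : vectType K) (n : nat)
    (B : n.-tuple V) (f : {symmetric V}) : 'M[K]_n :=
  \matrix_(j, k) f (tnth B j) (tnth B k).

(* Isotropic basis vectors are allowed: nothing is required of F i w_j w_j. *)
Definition simultaneously_orthogonalizable (K : fieldType) (V : vectType K)
    (J : Type) (F : J -> {symmetric V}) : Prop :=
  exists2 w : (\dim {:V}).-tuple V, basis_of fullv w &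
    forall (i : J) (j k : 'I_(\dim {:V})),
      j != k -> F i (tnth w j) (tnth w k) = 0.

(* Main.v *)
(* Let N_i = M_i M_0^-1. If P is the matrix of an orthogonal basis, every Gram
   matrix is P D_i P^T with D_i diagonal, so N_i = P (D_i D_0^-1) P^-1.
   Conversely, symmetry of M_i makes N_i self-adjoint for M_0, and the N_i have
   a common eigenbasis. Take an orthogonal family W of nonisotropic common
   eigenvectors that is not yet a basis: the M_0-orthogonal projection along W
   commutes with every N_i, so it sends the eigenbasis to common eigenvectors,
   which span the nondegenerate complement of W. One of them, or the sum of two
   of them having the same eigenvalues, is nonisotropic (as char K <> 2) and
   extends W. *)
Require Import Defs.
From HB Require Import structures.
From mathcomp Require Import all_boot all_order all_algebra.
From Stdlib Require Import Classical.

Set Implicit Arguments.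
Unset Strict Implicit.
Unset Printing Implicit Defensive.

Import GRing.Theory.
Local Open Scope ring_scope.

(** As long as some [A i] lies outside the span of a finite subfamily, adjoining it raises the
    dimension, which cannot exceed that of [V]. Since [I] is arbitrary, excluded middle decides
    whether such an [i] exists. *)
Lemma exists_spanning_seq (K : fieldType) (V : vectType K) (I : Type)
    (A : I -> V) : exists s : seq I, forall i, A i \in <<map A s>>%VS.
Proof.
suff [//|[s]] : (exists s : seq I, forall i, A i \in <<map A s>>%VS) \/
    exists s : seq I, (\dim {:V} < \dim <<map A s>>)%N.
  by rewrite ltnNge dimvS ?subvf.
elim: (\dim {:V}).+1 => [|k [|[s le_ks]]]; [by right; exists [::] | by left |].
have [[i Ai]|allA] := classic (exists i, A i \notin <<map A s>>%VS); last first.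
  left; exists s => i; case: (boolP (A i \in _)) => // Ai.
  by case: allA; exists i.
right; exists (i :: s); apply: leq_ltn_trans le_ks _; rewrite /= span_cons.
rewrite (ltn_leqif (dimv_leqif_sup (addvSr _ _))) subv_add subvv andbT.
by rewrite -memvE.
Qed.

Lemma mem_map_exists (I : Type) (T : eqType) (f : I -> T) (s : seq I) x :
  x \in map f s -> exists i, x = f i.
Proof. by elim: s => //= i s IHs; rewrite inE => /predU1P[->|//]; exists i. Qed.

(* codiagonalizableP is about finite sequences; it is applied to a finite
   subfamily that spans the same space of matrices. *)
Lemma commuting_diagonalizable_family (K : fieldType) n (I : Type)
    (A : I -> 'M[K]_n) :
  (forall i j, comm_mx (A i) (A j)) -> (forall i, diagonalizable (A i)) ->
  exists2 P : 'M[K]_n, P \in unitmx & forall i, similar_diag P (A i).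
Proof.
move=> Acomm Adiag; have [s As] := exists_spanning_seq A.
have /codiagonalizableP [P Pu /allP PAs] :
    {in [seq A i | i <- s] &, forall B C, comm_mx B C} /\
    {in [seq A i | i <- s], forall B, diagonalizable B}.
  split=> [B C /mem_map_exists[i ->] /mem_map_exists[j ->]//|].
  by move=> B /mem_map_exists[i ->].
exists P => // i.
rewrite /similar_to conjumx //; apply/is_diag_mxP => j k neq_jk.
(* Off-diagonal entries of the conjugate by [P] are linear in the matrix, so they vanish on the
   whole span. *)
rewrite (coord_span (X := in_tuple _) (As i)) mulmx_sumr mulmx_suml summxE.
rewrite big1 // => l _; rewrite -scalemxAr -scalemxAl mxE.
have /PAs : (in_tuple [seq A i | i <- s])`_l \in [seq A i | i <- s].
  exact: mem_nth.
rewrite /= /similar_to conjumx // => /is_diag_mxP -> //.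
by rewrite mulr0.
Qed.

Section OrthogonalEigenrows.
Context (K : fieldType) (n : nat) (I : Type).
Variables (S : 'M[K]_n) (A : I -> 'M[K]_n).
Hypotheses (charK : 2%N \notin [pchar K]) (Ssym : S^T = S) (Su : S \in unitmx).
Hypothesis A_selfadj : forall i, A i *m S = S *m (A i)^T.

(** Rows are common left eigenvectors. Zero rows are allowed, since projecting an eigenbasis may
    produce them. *)
Definition eigenrows m (W : 'M[K]_(m, n)) :=
  forall i, exists d, W *m A i = diag_mx d *m W.

(** For a diagonal Gram matrix, invertibility says that every row is nonisotropic. *)
Definition nondeg_orthogonal m (W : 'M[K]_(m, n)) :=
  is_diag_mx (W *m S *m W^T) && (W *m S *m W^T \in unitmx).

Lemma eigenrows_nonisotropic m (R : 'M[K]_(m, n)) :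
  eigenrows R -> R *m S *m R^T != 0 ->
  exists2 v : 'rV_n, eigenrows v /\ (v <= R)%MS & v *m S *m v^T \in unitmx.
Proof.
move=> Reig RSR0.
have unit11 (M : 'M[K]_1) : (M \in unitmx) = (M 0 0 != 0).
  by rewrite unitmxE unitfE det_mx11.
pose b j k := (R *m S *m R^T) j k.
have entryE j k : row j R *m S *m (row k R)^T = (b j k)%:M.
  rewrite /b -row_mul tr_row; apply/matrixP => x y; rewrite !ord1 !mxE /=.
  by rewrite mulr1n; apply: eq_bigr => l _; rewrite !mxE.
have bsym j k : b j k = b k j.
  have bT : (R *m S *m R^T)^T = R *m S *m R^T.
    by rewrite !trmx_mul trmxK Ssym mulmxA.
  by rewrite /b -[in LHS]bT mxE.
have rowE i d j : R *m A i = diag_mx d *m R -> row j R *m A i = d 0 j *: row j R.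
  by move=> Rd; rewrite -row_mul Rd; apply/rowP=> k; rewrite mul_diag_mx !mxE.
have rowOK j : b j j != 0 ->
    exists2 v : 'rV_n, eigenrows v /\ (v <= R)%MS & v *m S *m v^T \in unitmx.
  move=> bj; exists (row j R); last by rewrite entryE unit11 !mxE.
  split=> [i|]; last exact: row_sub.
  by have [d /rowE->] := Reig i; exists (const_mx (d 0 j)); rewrite diag_const_mx mul_scalar_mx.
have [[j k] /= bjk] : exists jk : 'I_m * 'I_m, b jk.1 jk.2 != 0.
  apply/existsP; apply: contraNT RSR0; rewrite negb_exists => /forallP b0.
  apply/eqP/matrixP=> j k; rewrite [RHS]mxE.
  by have /negPn/eqP := b0 (j, k).
have [bj|/rowOK//] := eqVneq (b j j) 0.
have [bk|/rowOK//] := eqVneq (b k k) 0.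
(* Self-adjointness and [b j k != 0] force rows j and k to share eigenvalues. *)
exists (row j R + row k R).
  split=> [i|]; last by rewrite addmx_sub ?row_sub.
  have [d Rd] := Reig i; exists (const_mx (d 0 j)).
  suff djk : d 0 k = d 0 j.
    by rewrite mulmxDl !(rowE _ _ _ Rd) djk -scalerDr diag_const_mx mul_scalar_mx.
  apply: (mulIf bjk).
  have : row j R *m A i *m S *m (row k R)^T
       = row j R *m S *m (row k R *m A i)^T.
    by rewrite trmx_mul -!mulmxA (mulmxA (A i)) A_selfadj -!mulmxA.
  rewrite !(rowE _ _ _ Rd) linearZ -!scalemxAl -scalemxAr /= entryE.
  by move/matrixP/(_ 0 0); rewrite !mxE.
(* With both rows isotropic, their sum pairs with itself to [2 * b j k], nonzero as the
   characteristic is not 2. *)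
rewrite unit11 linearD /= mulmxDl mulmxDr !mulmxDl !entryE bj bk (bsym k j) !mxE.
rewrite /= !mulr1n add0r addr0 -mulr2n -mulr_natl mulf_neq0 //.
Qed.

Lemma extend_nondeg_orthogonal m (P : 'M[K]_n) (W : 'M[K]_(m, n)) :
  P \in unitmx -> eigenrows P -> (m < n)%N ->
  eigenrows W -> nondeg_orthogonal W ->
  exists2 W' : 'M[K]_(m.+1, n), eigenrows W' & nondeg_orthogonal W'.
Proof.
move=> Pu Peig lt_mn Weig /andP[Gdiag Gu].
set G := W *m S *m W^T in Gdiag Gu.
have Gsym : G^T = G by rewrite !trmx_mul trmxK Ssym mulmxA.
(* Right multiplication by E projects onto the S-orthogonal complement of W. *)
pose E := 1%:M - S *m W^T *m invmx G *m W.
have ESsym : E *m S = S *m E^T.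
  rewrite mulmxBl mul1mx linearB /= trmx1 mulmxBr mulmx1; congr (_ - _).
  by rewrite !trmx_mul trmxK trmx_inv Gsym Ssym !mulmxA.
have ESW : E *m S *m W^T = 0.
  rewrite !mulmxBl !mul1mx -!mulmxA (mulmxA W) -/G mulVmx // mulmx1.
  by rewrite subrr.
have EE : E *m E = E.
  by rewrite {2}/E mulmxBr mulmx1 !mulmxA ESW !mul0mx subr0.
(* If [E] were 0, the identity would factor through [W], whose rank is at most [m < n]. *)
have E0 : E != 0.
  apply: contraTneq lt_mn => /eqP; rewrite subr_eq0 => /eqP E1.
  rewrite -leqNgt -[X in (X <= _)%N](mxrank1 K) E1.
  exact: leq_trans (mxrankM_maxr _ _) (rank_leq_row _).
(* With [D = diag_mx d], this reduces to [D] commuting with the inverse of [G], which holds because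
   both are diagonal. *)
have AE i : A i *m E = E *m A i.
  have [d Wd] := Weig i.
  rewrite mulmxBr mulmxBl mulmx1 mul1mx; congr (_ - _).
  rewrite -!mulmxA Wd !mulmxA A_selfadj -(mulmxA S) -trmx_mul Wd trmx_mul.
  rewrite tr_diag_mx -!mulmxA; congr (_ *m (_ *m _)); rewrite !mulmxA.
  congr (_ *m _); have [g Gg] := diag_mxP _ Gdiag.
  have GD : diag_mx d *m G = G *m diag_mx d by rewrite Gg diag_mxC.
  by rewrite -[LHS](mulKmx Gu) (mulmxA G) -GD mulmxK.
have Reig : eigenrows (P *m E).
  move=> i; have [d Pd] := Peig i; exists d.
  by rewrite -mulmxA -AE !mulmxA Pd.
(* As [E] is a self-adjoint idempotent, the Gram matrix of [P *m E] is [P *m E *m S *m P^T]; it is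
   nonzero because [P] and [S] are invertible and [E] is not 0. *)
have [|v [veig /submxP[D vE]] vu] := eigenrows_nonisotropic Reig.
  apply: contraNneq E0 => RSR0.
  rewrite -[E](mulmxK Su) -[E *m S](mulKmx Pu) -[P *m _](@mulmxK _ _ _ P^T).
    suff -> : P *m (E *m S) *m P^T = 0 by rewrite mul0mx mulmx0 mul0mx.
    have ESE : E *m S *m E^T = E *m S by rewrite -mulmxA -ESsym mulmxA EE.
    by rewrite -RSR0 trmx_mul -ESE !mulmxA.
  by rewrite unitmx_tr.
have vSW : v *m S *m W^T = 0 by rewrite vE -!mulmxA (mulmxA E) ESW !mulmx0.
have WSv : W *m S *m v^T = 0.
  by apply: trmx_inj; rewrite !trmx_mul trmxK Ssym mulmxA vSW trmx0.
suff: exists2 W' : 'M[K]_(1 + m, n), eigenrows W' & nondeg_orthogonal W' by [].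
exists (col_mx v W).
  move=> i; have [d vd] := veig i; have [d' Wd] := Weig i; exists (row_mx d d').
  by rewrite mul_col_mx vd Wd diag_mx_row mul_block_col !mul0mx addr0 add0r.
rewrite /nondeg_orthogonal mul_col_mx tr_col_mx mul_col_row vSW WSv -/G.
rewrite is_diag_block_mx // !eqxx mx11_is_diag Gdiag.
by rewrite unitmxE det_ublock unitrM -!unitmxE vu Gu.
Qed.

Lemma exists_orthogonal_eigenbasis (P : 'M[K]_n) :
  P \in unitmx -> eigenrows P ->
  exists2 W : 'M[K]_n, eigenrows W & nondeg_orthogonal W.
Proof.
move=> Pu Peig.
suff: forall m, (m <= n)%N ->
  exists2 W : 'M[K]_(m, n), eigenrows W & nondeg_orthogonal W by apply.
elim=> [_|m IHm lt_mn].
  (* The empty family qualifies: its 0 x 0 Gram matrix has determinant 1. *)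
  exists 0 => [i|]; first by exists 0; rewrite mul0mx mulmx0.
  by rewrite /nondeg_orthogonal !mul0mx mx0_is_diag unitmxE det_mx00 unitr1.
by have [W] := IHm (ltnW lt_mn); exact: (extend_nondeg_orthogonal Pu).
Qed.

End OrthogonalEigenrows.

Lemma gram_sym (K : fieldType) (V : vectType K) n (B : n.-tuple V)
    (f : {symmetric V}) : (gram B f)^T = gram B f.
Proof. by apply/matrixP=> j k; rewrite !mxE hermC expr0 mul1r. Qed.

Lemma gram_change (K : fieldType) (V : vectType K) m n (B : n.-tuple V)
    (C : m.-tuple V) (P : 'M[K]_(m, n)) (f : {symmetric V}) :
  (forall j, tnth C j = \sum_k P j k *: tnth B k) ->
  gram C f = P *m gram B f *m P^T.
Proof.
move=> CB; apply/matrixP=> j k; rewrite !mxE !CB linear_sumr /=.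
apply: eq_bigr => l _; rewrite linear_sumlz !mxE big_distrl /=.
apply: eq_bigr => l' _.
by rewrite !mxE linearZr_LR linearZl_LR /= mulrC.
Qed.

Lemma basis_of_unitmx_change (K : fieldType) (V : vectType K) (U : {vspace V}) n
    (B C : n.-tuple V) (P : 'M[K]_n) :
  basis_of U B -> P \in unitmx ->
  (forall j, tnth C j = \sum_k P j k *: tnth B k) -> basis_of U C.
Proof.
move=> Bbasis Pu CB.
rewrite basisEdim (size_basis Bbasis) size_tuple leqnn andbT.
rewrite -(span_basis Bbasis); apply/span_subvP => _ /tnthP[k ->].
have -> : tnth B k = \sum_j invmx P k j *: tnth C j.
  have PVP l : \sum_j invmx P k j *: (P j l *: tnth B l)
      = (k == l)%:R *: tnth B l.
    under eq_bigr do rewrite scalerA.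
    rewrite -scaler_suml; have /matrixP/(_ k l) := mulVmx Pu.
    by rewrite !mxE => ->.
  under eq_bigr do rewrite CB scaler_sumr.
  rewrite exchange_big /=; under eq_bigr do rewrite PVP.
  rewrite (bigD1 k) //= eqxx scale1r big1 ?addr0 // => l.
  by rewrite eq_sym => /negPf->; rewrite scale0r.
by apply: memv_suml => j _; rewrite memvZ // memv_span ?mem_tnth.
Qed.

(* The index set I U {0} is option I, with None playing the role of 0. *)
Theorem corollary1 (K : fieldType) (V : vectType K) (n : nat)
    (B : n.-tuple V) (I : Type) (F : option I -> {symmetric V})
    (charK : 2%N \notin [pchar K])
    (basisB : basis_of fullv B)
    (M0_unit : gram B (F None) \in unitmx) :
  simultaneously_orthogonalizable F <->
  (forall i j : I,
     comm_mx (gram B (F (Some i)) *m invmx (gram B (F None)))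
             (gram B (F (Some j)) *m invmx (gram B (F None)))) /\
  (forall i : I,
     diagonalizable (gram B (F (Some i)) *m invmx (gram B (F None)))).
Proof.
have dimV := size_basis basisB; rewrite /simultaneously_orthogonalizable dimV.
pose M i := gram B (F i).
have Msym i : (M i)^T = M i := gram_sym B (F i).
rewrite -!/(M _) in M0_unit *; split=> [[w wbasis w_orth] | [Mcomm Mdiag]].
  pose P : 'M[K]_n := \matrix_(j, k) coord w k (tnth B j).
  have BP j : tnth B j = \sum_k P j k *: tnth w k.
    rewrite [LHS](coord_basis wbasis (memvf _)).
    by apply: eq_bigr => k _; rewrite mxE -tnth_nth.
  have grampf i : exists d, M i = P *m diag_mx d *m P^T.
    have /diag_mxP[d wd] : is_diag_mx (gram w (F i)).
      by apply/is_diag_mxP => j k neq_jk; rewrite mxE w_orth.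
    by exists d; rewrite -wd; apply: gram_change.
  have [d0 M0E] := grampf None.
  (* All three are square factors of the invertible [M None]; in particular [d0] has no zero
     entry. *)
  have /andP[/andP[Pu d0u] PTu] :
      (P \in unitmx) && (diag_mx d0 \in unitmx) && (P^T \in unitmx).
    by rewrite -!unitmx_mul -M0E.
  have NP i : exists d, M (Some i) *m invmx (M None) = P *m diag_mx d *m invmx P.
    have [d Md] := grampf (Some i).
    exists (\row_k (d 0 k / d0 0 k)); apply: (canLR (mulmxK M0_unit)).
    rewrite Md M0E !mulmxA mulmxKV //; congr (_ *m _); rewrite -!mulmxA.
    congr (_ *m _); rewrite mulmx_diag; congr diag_mx; apply/rowP => k.
    rewrite !mxE divfK //; move: d0u; rewrite unitmxE det_diag unitfE.
    by move/prodf_neq0; apply.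
  have Ndiag i : similar_diag (invmx P) (M (Some i) *m invmx (M None)).
    have [d ->] := NP i; rewrite /similar_to conjVmx // -!mulmxA mulVmx // mulmx1.
    by rewrite mulKmx // diag_mx_is_diag.
  split=> [i j|i]; last by exists (invmx P); [rewrite unitmx_inv | exact: Ndiag].
  have [d ->] := NP i; have [e ->] := NP j.
  by rewrite /comm_mx !mulmxA !mulmxKV // -!(mulmxA P) diag_mxC.
have [P Pu Pdiag] := commuting_diagonalizable_family Mcomm Mdiag.
pose N i := M (Some i) *m invmx (M None).
have NM i : N i *m M None = M (Some i) by rewrite mulmxKV.
have N_selfadj i : N i *m M None = M None *m (N i)^T.
  by rewrite NM -[M None in RHS]Msym -trmx_mul NM Msym.
(* [P *m N i *m invmx P] being diagonal means that the rows of [P] are left eigenvectors of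
   [N i]. *)
have Peig : eigenrows N P.
  by move=> i; have /diag_mxP[d PNd] := Pdiag i; exists d; apply/similarP=> //; apply/eqP.
have [W Weig /andP[Gdiag Gu]] :=
  exists_orthogonal_eigenbasis charK (Msym None) M0_unit N_selfadj Pu Peig.
have Wu : W \in unitmx by move: Gu; rewrite !unitmx_mul => /andP[/andP[]].
pose w := [tuple \sum_k W j k *: tnth B k | j < n].
have wB j : tnth w j = \sum_k W j k *: tnth B k by rewrite tnth_mktuple.
exists w; first exact: basis_of_unitmx_change wB.
(* For [Some i], writing [M (Some i)] as [N i *m M None] turns this Gram matrix into [diag_mx d]
   times the diagonal Gram matrix for [None]. *)
have gram_diag i : is_diag_mx (gram w (F i)).
  rewrite (gram_change _ wB) -/(M i); case: i => [i|//].
  have [d Wd] := Weig i; have [g Gg] := diag_mxP _ Gdiag.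
  by rewrite -NM mulmxA Wd -!mulmxA (mulmxA W) Gg mulmx_diag diag_mx_is_diag.
by move=> i j k neq_jk; have /is_diag_mxP/(_ j k neq_jk) := gram_diag i; rewrite mxE.
Qed.
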